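(* Let $g \geq 2$ be a fixed even integer. Then there exist arbitrarily large $q$ and primitive Dirichlet characters $\chi \pmod q$ of order $g$ satisfying $$M(\chi) \gg_g \sqrt{q}\, \log\log q.$$ That is, there is a constant $c_g > 0$ depending only on $g$ such that for every $Y$ there exist an integer $q > Y$ and a primitive Dirichlet character $\chi \pmod q$ of order $g$ with $M(\chi) \geq c_g \sqrt{q}\,\log\log q$.
   Context: For a nonprincipal Dirichlet character $\chi \pmod q$, define $$M(\chi) := \max_{t \leq q} \left| \sum_{n \leq t} \chi(n) \right|,$$ where the inner sum is over positive integers $n \leq t$. The order of $\chi$ is its order in the group of Dirichlet characters modulo $q$, i.e. the least positive integer $k$ such that $\chi^k$ is principal. The notation $f \gg_g h$ (for nonnegative $f,h$) means $f \geq c\,h$ for some constant $c>0$ depending only on $g$. *)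

(* Defs.v *)
From HB Require Import structures.
From mathcomp Require Import all_boot all_order all_algebra.
From mathcomp Require Import complex reals exp.

Set Implicit Arguments.
Unset Strict Implicit.
Unset Printing Implicit Defensive.
Import Order.TTheory GRing.Theory Num.Theory.
Local Open Scope ring_scope.
Local Open Scope complex_scope.

(* A Dirichlet character mod [q] is viewed as a function on all the integers,
   extended by zero to the integers not coprime to [q]. *)
Record dirichletChar (R : rcfType) (q : nat) := DirichletChar {
  dchar_fun :> int -> R[i];
  dchar_modulus_gt0 : (0 < q)%N;
  dcharM : forall m n : int, dchar_fun (m * n) = dchar_fun m * dchar_fun n;
  dchar_periodic : forall n : int, dchar_fun (n + q%:Z) = dchar_fun n;
  dchar_neq0 : forall n : int, (dchar_fun n != 0) = coprimez n q%:Z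
}.

Definition principal_fun (R : rcfType) (q : nat) (n : int) : R[i] :=
  (coprimez n q%:Z)%:R.

(* [k > 0] is necessary here: the pointwise 0-th power of [chi] is the constant
   function 1, not the principal character. *)
Definition has_order (R : rcfType) (q : nat) (chi : dirichletChar R q)
    (k : nat) : Prop :=
  let kills j := forall n : int, chi n ^+ j = principal_fun R q n in
  [/\ (0 < k)%N, kills k & forall j : nat, (0 < j)%N -> kills j -> (k <= j)%N].

Definition induced_by (R : rcfType) (q d : nat) (chi : dirichletChar R q)
    (psi : dirichletChar R d) : Prop :=
  (d %| q)%N /\ forall n : int, coprimez n q%:Z -> chi n = psi n.

Definition primitive (R : rcfType) (q : nat) (chi : dirichletChar R q) : Prop :=
  forall (d : nat) (psi : dirichletChar R d), (d < q)%N -> ~ induced_by chi psi.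

(* The maximum is over integer [t]: the partial sums are constant between
   consecutive integers. *)
Definition max_char_sum (R : rcfType) (q : nat) (chi : dirichletChar R q) : R :=
  \big[Num.max/0]_(t < q.+1) Normc.normc (\sum_(1 <= n < t.+1) chi n%:Z).

(* Main.v *)
(** Let [psi] be a character of order [g] modulo a prime [m] with [m = 1] mod [g],
    and [xi] the Jacobi symbol modulo [d = 4 y! - 1]: it is odd, real, and equal to
    [1] at every [1 <= n <= y]. Since [g] is even, the primitive character [chi]
    mod [q] inducing [psi xi] has order [g]; moreover [chi k = psi k] and
    [chi (- k) = - psi (- k)] for [1 <= k <= y] coprime to [m], and
    [log log q << log y] because [q <= m d].

    Let [S t] be the partial sums of [chi] and [e x = exp (2 i pi x)]. Their discrete
    Fourier coefficient at [k] coprime to [q] is [tau(chi) conj (chi k) / (1 - e (k / q))].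
    Test [S] against the kernel [\sum_(i, j < N) psi (i - j) e (t (i - j) / q)].
    Expanding [psi] in additive characters mod [m] shows that this is a bounded
    combination of [m] translates of the Fejer kernel, so its l^1-norm in [t] is at
    most [m q N], whereas the pairing with [S] is
    [i tau(chi) \sum_(j < i < N, (i - j, m) = 1) cot (pi (i - j) / q)],
    as the terms of [k] and [- k] reinforce each other. The cotangents add up to
    about [q N log N], and [|tau(chi)| = sqrt q]. Taking [N] a small multiple of [y]
    gives [M(chi) >> sqrt q log y], with no information needed on [L(1, .)]. *)

Require Import Defs.
From mathcomp Require Import all_boot all_order all_algebra all_field.
From mathcomp Require Import complex reals exp.
From mathcomp Require Import boolp topology normedtype derive trigo.
From mathcomp Require Import zify ring lra.

Set Implicit Arguments.
Unset Strict Implicit.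
Unset Printing Implicit Defensive.
Import Order.TTheory GRing.Theory Num.Theory.
Local Open Scope ring_scope.

(** * Primes [p] with an element of order [g] in ['F_p] *)

Lemma cyclotomic_root_primitive (F : fieldType) (g : nat) (x : F) :
  (0 < g)%N -> g%:R != 0 :> F -> root (map_poly intr 'Phi_g) x ->
  g.-primitive_root x.
Proof.
move=> g_gt0 gF0 rx.
pose Psi e : {poly F} := map_poly intr 'Phi_e.
have XnE n : (0 < n)%N -> 'X^n - 1 = \prod_(e <- divisors n) Psi e.
  move=> n_gt0; rewrite -rmorph_prod /= prod_Cyclotomic // rmorphB /=.
  by rewrite map_polyXn rmorph1.
have hXn1 n : ('X^n - 1).[x] = x ^+ n - 1 by rewrite !hornerE.
have gdiv : g \in divisors g by rewrite -dvdn_divisors.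
have xg1 : x ^+ g = 1.
  apply/eqP; rewrite -subr_eq0 -hXn1 XnE // (bigD1_seq g) ?divisors_uniq //=.
  by rewrite hornerM (rootP rx) mul0r.
have [d dprim ddvd] := prim_order_exists g_gt0 xg1.
case: (eqVneq d g) => [<- //|dNg].
have d_gt0 := prim_order_gt0 dprim.
have [e edvd re] : exists2 e, (e %| d)%N & root (Psi e) x.
  have : root (\prod_(e <- divisors d) Psi e) x.
    by rewrite -XnE // rootE hXn1 prim_expr_order // subrr.
  rewrite -(big_map Psi xpredT id) -[root _ _]negbK root_bigmul.
  case/allPn => p /mapP[e]; rewrite -dvdn_divisors // => edvd -> /negPn re.
  by exists e.
have eNg : e != g.
  by apply: contraNneq dNg => eg; rewrite eqn_dvd ddvd -eg edvd.
(* Otherwise [x] is a double root of [X^g - 1]. *)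
have /(congr1 (fun p => p^`().[x])) := XnE g g_gt0.
rewrite (bigD1_seq g) ?divisors_uniq //= -big_filter.
rewrite (bigD1_seq e) ?filter_uniq ?divisors_uniq //=; last first.
  by rewrite mem_filter eNg -dvdn_divisors // (dvdn_trans edvd).
rewrite derivB derivXn derivC subr0 2!derivM !hornerE (rootP rx) (rootP re).
rewrite /= !mulr0 !mul0r addr0 hornerMn hornerXn => /eqP.
rewrite -mulr_natr mulf_eq0 (negPf gF0) orbF expf_eq0 => /andP[_ /eqP x0].
by move: xg1; rewrite x0 expr0n gtn_eqF // => /eqP; rewrite eq_sym oner_eq0.
Qed.

(** A prime divisor [p] of the value of ['Phi_g] at a multiple [a] of [g] cannot divide [g], since
    it divides [a ^+ g - 1]; hence [a] modulo [p] has order [g]. *)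
Lemma exists_prime_primitive_root (g : nat) : (0 < g)%N ->
  exists2 p, prime p & exists u : 'F_p, g.-primitive_root u.
Proof.
move=> g_gt0.
(* Off the roots of [Q] the value of ['Phi_g] is none of 0, 1, -1, so it has a prime divisor. *)
pose Q : {poly int} := 'Phi_g * ('Phi_g ^+ 2 - 1).
have szP : (1 < size ('Phi_g))%N by rewrite size_Cyclotomic ltnS totient_gt0.
have P0 : 'Phi_g != 0 :> {poly int} by rewrite -size_poly_gt0 (ltn_trans _ szP).
have Q0 : Q != 0.
  rewrite mulf_neq0 // subr_eq0; apply/eqP => /(congr1 (size \o polyseq)) /=.
  rewrite size_poly1 expr2 size_mul //; move: szP.
  by case: (size _) => [|[|n]] //; rewrite addnS.
(* These [size Q] distinct points cannot all be roots of [Q]. They are multiples of [g] so that a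
   prime dividing [g] also divides the chosen point. *)
pose s : seq int := [seq (g * k.+1)%:Z | k <- iota 0 (size Q)].
have [a sa Qa] : exists2 a, a \in s & ~~ root Q a.
  apply/allPn/negP => rs; have : (size s < size Q)%N.
    apply: max_poly_roots => //; rewrite map_inj_uniq ?iota_uniq // => i j [/eqP].
    by rewrite eqn_pmul2l // => /eqP[].
  by rewrite size_map size_iota ltnn.
have [k ak] : exists k, a = (g * k.+1)%N :> int by case/mapP: sa => k _ ->; exists k.
pose v := ('Phi_g).[a].
have v1 : (1 < `|v|)%N.
  move: Qa; rewrite rootE !hornerE -/v; case: v => [] [|[|n]] //=.
have pp := pdiv_prime v1; set p := pdiv _ in pp.
have pv : (p%:Z %| v)%Z by rewrite dvdzE; exact: pdiv_dvd.
have pF (z : int) : (z%:~R == 0 :> 'F_p) = (p%:Z %| z)%Z.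
  by rewrite (dvdz_pcharf (pchar_Fp pp)).
have rv : root (map_poly intr 'Phi_g) (a%:~R : 'F_p).
  by rewrite rootE horner_map pF.
exists p => //; exists (a%:~R : 'F_p); apply: cyclotomic_root_primitive => //.
apply/negP; rewrite -[g%:R]/((g%:Z)%:~R) pF => pg.
have pa : (p%:Z %| a)%Z by rewrite ak PoszM dvdz_mulr.
have : (p%:Z %| a ^+ g - 1)%Z.
  have -> : a ^+ g - 1 = ('X^g - 1).[a] by rewrite !hornerE.
  rewrite -prod_Cyclotomic //.
  rewrite (bigD1_seq g) ?divisors_uniq -?dvdn_divisors //= hornerM.
  exact: dvdz_mulr.
rewrite rpredBl; last first.
  by rewrite -(prednK g_gt0) exprS dvdz_mulr.
by rewrite dvdzE /= dvdn1 => /eqP p1; rewrite p1 in pp.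
Qed.

(** * Dirichlet characters *)

Section CharacterBasics.
Variables (R : rcfType) (q : nat).
Implicit Type chi : dirichletChar R q.

Lemma dchar_eqmod chi (m n : int) : (q%:Z %| m - n)%Z -> chi m = chi n.
Proof.
have per (k : nat) z : chi (z + k%:Z * q%:Z) = chi z.
  elim: k => [|k IHk]; first by rewrite mul0r addr0.
  by rewrite -addn1 PoszD mulrDl mul1r addrA dchar_periodic.
case/dvdzP=> k /eqP; rewrite subr_eq => /eqP ->; rewrite addrC.
case: k => k; first by rewrite per.
by rewrite NegzE mulNr -[LHS](per k.+1) subrK.
Qed.

Lemma dchar1 chi : chi 1 = 1.
Proof.
have c1 : chi 1 != 0 by rewrite dchar_neq0 /coprimez gcd1z.
by apply: (mulfI c1); rewrite -dcharM !mulr1.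
Qed.

Lemma dchar_eq0 chi n : ~~ coprimez n q%:Z -> chi n = 0.
Proof. by rewrite -(dchar_neq0 chi) negbK => /eqP. Qed.

Lemma has_order_pos chi k : has_order chi k -> (0 < k)%N.
Proof. by case. Qed.

Lemma has_order_expr chi k n :
  has_order chi k -> coprimez n q%:Z -> chi n ^+ k = 1.
Proof. by case=> _ kk _ cn; rewrite kk /principal_fun cn. Qed.

End CharacterBasics.

Lemma dvdz_small_eq0 (d : nat) (e : int) : (d%:Z %| e)%Z -> `|e| < d%:Z -> e = 0.
Proof.
case/dvdzP=> k ->; have [-> _|k0] := eqVneq k 0; first by rewrite mul0r.
by rewrite normrM ltNge ler_peMl //; lia.
Qed.

Lemma coprimez_eqmod (q : nat) (m n : int) :
  (q%:Z %| m - n)%Z -> coprimez m q%:Z = coprimez n q%:Z.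
Proof.
case/dvdzP=> k /eqP; rewrite subr_eq => /eqP ->.
by rewrite /coprimez ![gcdz _ q%:Z]gcdzC gcdzMDl.
Qed.

Lemma lift_coprime (Q q : nat) (n : int) : (0 < Q)%N -> coprimez n q%:Z ->
  exists2 n' : int, (q%:Z %| n' - n)%Z & coprimez n' Q%:Z.
Proof.
move=> Q_gt0 cnq.
(* [n + t q] is divisible by no prime [r] dividing [Q]: [r] divides exactly one of
   [n] and [t], and is prime to [q] if it divides [n]. *)
pose t := (\prod_(r <- primes Q | ~~ (r %| `|n|)) r)%N.
exists (n + t%:Z * q%:Z); first by rewrite addrC addKr dvdz_mull.
apply: contraT; rewrite coprimezE /coprime neq_ltn ltnS leqn0.
rewrite -[gcdn _ _ == 0%N]negbK -lt0n gcdn_gt0 [(0 < `|Q|)%N]Q_gt0 orbT /=.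
set G := gcdn _ _ => G1; set r := pdiv G.
have rp : prime r := pdiv_prime G1.
have rn : (r%:Z %| n + t%:Z * q%:Z)%Z by rewrite dvdzE (dvdn_trans (pdiv_dvd G)) ?dvdn_gcdl.
have rQ : r \in primes Q.
  by rewrite mem_primes rp Q_gt0 (dvdn_trans (pdiv_dvd G)) ?dvdn_gcdr.
have tE : (r %| t)%N = ~~ (r %| `|n|)%N.
  rewrite Euclid_dvd_prod // big_has_cond; apply/hasP/idP => [[s]|rn0].
    rewrite mem_primes => /and3P[sp _ _] /= /andP[sn].
    by rewrite dvdn_prime2 // => /eqP ->.
  by exists r; rewrite //= rn0 dvdnn.
case: (boolP (r %| `|n|)%N) => rdn; last first.
  have : (r%:Z %| n)%Z.
    have tq : (r%:Z %| t%:Z * q%:Z)%Z by rewrite dvdz_mulr // dvdzE tE.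
    by rewrite -(rpredDr _ tq).
  by rewrite dvdzE (negPf rdn).
have rdn' : (r%:Z %| n)%Z by rewrite dvdzE.
move: rn; rewrite (rpredDl _ rdn').
rewrite dvdzE abszM Euclid_dvdM // tE rdn /= => rq.
have := dvdn_gcd r `|n| q; rewrite rdn rq (eqP (cnq : coprime `|n| q)) dvdn1 => /eqP r1.
by move: rp; rewrite r1.
Qed.

Lemma mod_inverse (q : nat) (n : int) : coprimez n q%:Z ->
  exists2 u : int, (q%:Z %| u * n - 1)%Z & coprimez u q%:Z.
Proof.
case/coprimezP=> -[u v] /= uv; exists u.
  by apply/dvdzP; exists (- v); rewrite mulNr -uv; ring.
by apply/coprimezP; exists (n, v); rewrite /= mulrC.
Qed.

(** * Induced characters and primitivity *)

Section Descent.
Variables (R : rcfType) (q d : nat) (chi : dirichletChar R q).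
Hypothesis dq : (d %| q)%N.
Hypothesis chi1 :
  forall c : int, coprimez c q%:Z -> (d%:Z %| c - 1)%Z -> chi c = 1.

Lemma descent_eqmod (m n : int) : coprimez m q%:Z -> coprimez n q%:Z ->
  (d%:Z %| m - n)%Z -> chi m = chi n.
Proof.
move=> cm cn mn; have [u un cu] := mod_inverse cn.
have un' : (d%:Z %| u * n - 1)%Z by apply: dvdz_trans un; rewrite dvdzE.
have u0 : chi u != 0 by rewrite dchar_neq0.
apply: (mulfI u0); rewrite -!dcharM (dchar_eqmod chi un) dchar1 chi1 //.
  by rewrite coprimezMl cu.
have -> : u * m - 1 = u * (m - n) + (u * n - 1) by ring.
by rewrite rpredD // dvdz_mull.
Qed.

(** The value of [psi] at [n] is that of [chi] at any integer prime to [q] and congruent to [n]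
    modulo [d]: [lift_coprime] supplies one and [descent_eqmod] makes the choice immaterial. *)
Lemma descent : exists psi : dirichletChar R d, induced_by chi psi.
Proof.
have q0 := dchar_modulus_gt0 chi.
have d0 : (0 < d)%N by apply: dvdn_gt0 dq.
(* The default 0 is harmless: [f] reads [L n] only for [n] prime to [d]. *)
pose L n := if pselect (coprimez n d%:Z) is left cn
  then sval (cid2 (lift_coprime q0 cn)) else 0.
have LP n : coprimez n d%:Z -> (d%:Z %| L n - n)%Z /\ coprimez (L n) q%:Z.
  by rewrite /L => cn; case: pselect => // cn'; case: cid2.
pose f n := if coprimez n d%:Z then chi (L n) else 0.
have fE n n' : coprimez n' q%:Z -> (d%:Z %| n - n')%Z -> f n = chi n'.
  move=> cn' nn'.
  have cd' : coprimez n' d%:Z by apply: coprimez_dvdr cn'.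
  have cn : coprimez n d%:Z by rewrite (coprimez_eqmod nn').
  rewrite /f cn; have [Ln cL] := LP n cn; apply: descent_eqmod => //.
  have -> : L n - n' = (L n - n) + (n - n') by ring.
  exact: rpredD.
have fM m n : f (m * n) = f m * f n.
  case: (boolP (coprimez m d%:Z)) => cm; last first.
    by rewrite /f coprimezMl (negPf cm) mul0r.
  case: (boolP (coprimez n d%:Z)) => cn; last first.
    by rewrite /f coprimezMl (negPf cn) andbF mulr0.
  have [Lm cLm] := LP m cm; have [Ln cLn] := LP n cn.
  rewrite (fE _ (L m * L n)); first by rewrite dcharM /f cm cn.
    by rewrite coprimezMl cLm.
  have -> : m * n - L m * L n = - (L m - m) * n - L m * (L n - n) by ring.
  by apply: rpredB; [apply: dvdz_mulr; rewrite rpredN | apply: dvdz_mull].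
have fP n : f (n + d%:Z) = f n.
  have dn : (d%:Z %| n + d%:Z - n)%Z by rewrite addrAC subrr add0r dvdzz.
  have cE := coprimez_eqmod dn.
  case: (boolP (coprimez n d%:Z)) => cn; last by rewrite /f cE (negPf cn).
  have [Ln cLn] := LP n cn.
  rewrite (fE _ (L n)) //; first by rewrite /f cn.
  have -> : n + d%:Z - L n = (n + d%:Z - n) - (L n - n) by ring.
  exact: rpredB.
have fN0 n : (f n != 0) = coprimez n d%:Z.
  rewrite /f; case: ifP => [cn|_]; last by rewrite eqxx.
  by rewrite dchar_neq0; case: (LP n cn).
exists (DirichletChar d0 fM fP fN0); split=> // n cn /=.
by rewrite (fE n n) // subrr dvdz0.
Qed.

End Descent.

(** Strong induction on the modulus: a character that is not primitive is induced by one of smaller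
    modulus, and induction of characters is transitive. *)
Lemma exists_primitive_inducing (R : rcfType) (Q : nat) (chi : dirichletChar R Q) :
  exists (q : nat) (chi' : dirichletChar R q), primitive chi' /\ induced_by chi chi'.
Proof.
have [n] := ubnP Q; elim: n => // n IHn in Q chi *; rewrite ltnS => leQn.
have [prim | ] := pselect (primitive chi).
  by exists Q, chi; split=> //; split.
move/existsNP=> [d /existsNP[psi /not_implyP[dQ /contrapT[dvdQ chiE]]]].
have [q [chi' [prim [qd psiE]]]] := IHn d psi (leq_trans dQ leQn).
exists q, chi'; split=> //; split; first exact: dvdn_trans dvdQ.
by move=> k ck; rewrite chiE // psiE //; apply: coprimez_dvdr ck.
Qed.

(** * A character of order [g] modulo a prime *)

Section PrimeModulus.
Variables (R : rcfType) (p g : nat) (u : 'F_p) (z : R[i]).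
Hypotheses (pp : prime p) (up : g.-primitive_root u) (zp : g.-primitive_root z).

(** The [g]-th power residue symbol: for [x] nonzero in ['F_p], [x ^+ ((p - 1) / g)] is a power of
    [u], and [psi] takes the same power of [z]. *)
Lemma exists_dchar_order : exists psi : dirichletChar R p, has_order psi g.
Proof.
have p0 := prime_gt0 pp; have p1 := prime_gt1 pp.
have g0 := prim_order_gt0 up.
have F0 n : ((n%:~R : 'F_p) != 0) = coprimez n p%:Z.
  rewrite coprimez_sym coprimezE prime_coprime // -(dvdz_pcharf (pchar_Fp pp)) //.
have fermat (x : 'F_p) : x != 0 -> x ^+ p.-1 = 1.
  move=> x0; apply: (mulfI x0); rewrite -exprS prednK // mulr1.
  by rewrite -{2}(expf_card x) card_Fp.
have gp : (g %| p.-1)%N.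
  rewrite (prim_order_dvd up) fermat //; apply/negP => /eqP u0.
  have := prim_expr_order up; rewrite u0 expr0n gtn_eqF //.
pose e := (p.-1 %/ g)%N.
have ge : (e * g)%N = p.-1 by rewrite divnK.
(* Discrete logarithm of [x ^+ e] to the base [u]; the default index can only be reached at
   [x = 0]. *)
pose lg x : nat := odflt (Ordinal g0) [pick i : 'I_g | u ^+ i == x ^+ e].
have lgP x : x != 0 -> u ^+ lg x = x ^+ e.
  move=> x0; rewrite /lg; case: pickP => [i /eqP //|noi].
  have xe1 : (x ^+ e) ^+ g = 1 by rewrite -exprM ge fermat.
  by have [i xi] := prim_rootP up xe1; have := noi i; rewrite xi eqxx.
pose f (n : int) := if (n%:~R : 'F_p) == 0 then 0 else z ^+ lg n%:~R.
have z0 : z != 0.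
  apply/negP => /eqP z0; have := prim_expr_order zp.
  by rewrite z0 expr0n gtn_eqF // => /esym/eqP; rewrite oner_eq0.
have fM m n : f (m * n) = f m * f n.
  rewrite /f intrM mulf_eq0; case: eqVneq => [|m0] /=; first by rewrite mul0r.
  case: eqVneq => [|n0] /=; first by rewrite mulr0.
  apply/eqP; rewrite -exprD (eq_prim_root_expr zp) -(eq_prim_root_expr up).
  by rewrite exprD !lgP ?mulf_neq0 // exprMn.
have fP n : f (n + p%:Z) = f n.
  by rewrite /f intrD -[p%:~R]/(p%:R : 'F_p) pchar_Fp_0 // addr0.
have fN0 n : (f n != 0) = coprimez n p%:Z.
  rewrite -F0 /f; case: (eqVneq (n%:~R : 'F_p) 0) => [|_]; first by rewrite eqxx.
  by rewrite expf_neq0.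
exists (DirichletChar p0 fM fP fN0); split=> //= [n|j j0 kj].
  rewrite /principal_fun -F0 /f; case: eqVneq => _ /=.
    by rewrite expr0n gtn_eqF.
  by rewrite exprAC (prim_expr_order zp) expr1n.
rewrite leqNgt; apply/negP => jg.
have je0 : (0 < e * j)%N.
  by rewrite muln_gt0 j0 andbT; move: ge; case: (e) => //; rewrite mul0n; lia.
(* If [psi ^ j] is principal, all [p - 1] nonzero residues are roots of [X^(e j) - 1],
   so [p - 1 = e g <= e j]. *)
have [rs] : exists2 rs : seq 'F_p, uniq rs & all (e * j).-unity_root rs /\ size rs = p.-1.
  exists (enum (predC1 (0 : 'F_p))); first exact: enum_uniq.
  split; last by rewrite -cardE cardC1 card_Fp.
  apply/allP => x; rewrite mem_enum inE => x0.
  have xE : x = (x : nat)%:~R by rewrite -pmulrn natr_Zp.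
  apply/unity_rootP; rewrite exprM -lgP // -exprM; apply/eqP.
  rewrite -(prim_order_dvd up) (prim_order_dvd zp).
  have := kj (x : nat)%:Z; rewrite /f -xE (negPf x0) /principal_fun -F0 -xE x0.
  by rewrite -exprM => ->.
move=> urs [rsr szrs].
have := max_unity_roots je0 rsr urs; rewrite szrs -ge leq_pmul2l; first by rewrite leqNgt jg.
by move: je0; rewrite muln_gt0 => /andP[].
Qed.

End PrimeModulus.

(** * Gauss's lemma and the quadratic character *)

Section GaussLemma.
Variables (R : rcfType) (h : nat).
Let d := h.*2.+1.

(** The sign of the residue of [z] of least absolute value modulo [d]. *)
Definition half_sign (z : int) : R[i] :=
  let r := (z %% d%:Z)%Z in
  if r == 0 then 0 else if r <= h%:Z then 1 else -1.

(** For [z] not divisible by [d], the absolute value of that residue, lowered by one so as to index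
    ['I_h]. *)
Definition half_index (z : int) : nat :=
  let r := (z %% d%:Z)%Z in
  if r <= h%:Z then `|r|.-1 else (d - `|r|).-1.

Lemma half_sign_eqmod (y z : int) :
  (d%:Z %| y - z)%Z -> half_sign y = half_sign z.
Proof. by rewrite -eqz_mod_dvd /half_sign => /eqP ->. Qed.

Lemma half_sign_small (z : int) : 0 < z <= h%:Z -> half_sign z = 1.
Proof.
move=> zh; rewrite /half_sign modz_small; last by rewrite /d; lia.
by case: ifP => [|_]; [lia | rewrite ifT //; lia].
Qed.

Lemma half_sign_large (z : int) : h%:Z < z < d%:Z -> half_sign z = -1.
Proof.
move=> zh; rewrite /half_sign modz_small; last by lia.
by case: ifP => [|_]; [lia | rewrite ifF //; lia].
Qed.

Let resP z : exists2 r, (z %% d%:Z)%Z = r & [/\ 0 <= r, r < d%:Z & (d%:Z %| z - r)%Z].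
Proof.
exists (z %% d%:Z)%Z => //; split; first exact: modz_ge0.
  exact: ltz_pmod.
by rewrite -eqz_mod_dvd modz_mod.
Qed.

Lemma half_signN (z : int) : half_sign (- z) = - half_sign z.
Proof.
have [r _ [r0 rd zr]] := resP z.
rewrite (half_sign_eqmod zr).
have -> : half_sign (- z) = half_sign (- r).
  by apply: half_sign_eqmod; rewrite -opprD rpredN.
case: (eqVneq r 0) => [->|rN0]; first by rewrite oppr0 /half_sign mod0z eqxx oppr0.
have -> : half_sign (- r) = half_sign (d%:Z - r).
  by apply: half_sign_eqmod; rewrite opprB addKr rpredN dvdzz.
have [rh|rh] := leP r h%:Z.
  by rewrite half_sign_large ?half_sign_small //; rewrite /d in rd *; lia.
by rewrite half_sign_small ?half_sign_large ?opprK //; rewrite /d in rd *; lia.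
Qed.

Lemma half_sign_neq0 (z : int) : (half_sign z != 0) = ~~ (d%:Z %| z)%Z.
Proof.
rewrite /half_sign; case: (boolP (d%:Z %| z)%Z) => [/dvdz_mod0P -> |]; first by rewrite !eqxx.
move=> nz; rewrite ifF; first by case: ifP; rewrite ?oppr_eq0 oner_eq0.
by apply: contraNF nz => /eqP/dvdz_mod0P.
Qed.

Lemma half_index_lt (z : int) : ~~ (d%:Z %| z)%Z -> (half_index z < h)%N.
Proof.
rewrite /half_index; have [r -> [r0 rd zr]] := resP z => nz.
have rN0 : r != 0.
  by apply: contraNneq nz => r00; move: zr; rewrite r00 subr0.
by move: rd; rewrite /d; case: ifP; lia.
Qed.

Lemma half_indexP (F : int -> R[i]) (z : int) :
  (forall x, F (x + d%:Z) = F x) -> (forall x, F (- x) = - F x) ->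
  ~~ (d%:Z %| z)%Z -> F z = half_sign z * F (half_index z).+1%:Z.
Proof.
move=> FP FN nz.
have FE x k : F (x + k * d%:Z) = F x.
  have per (j : nat) y : F (y + j%:Z * d%:Z) = F y.
    elim: j => [|j IHj]; first by rewrite mul0r addr0.
    by rewrite -addn1 PoszD mulrDl mul1r addrA FP.
  case: k => k; first exact: per.
  by rewrite NegzE mulNr -[LHS](per k.+1) subrK.
rewrite /half_index; have [r rE [r0 rd zr]] := resP z.
have rN0 : r != 0.
  by apply: contraNneq nz => r00; move: zr; rewrite r00 subr0.
have -> : F z = F r.
  by have /dvdzP[k /eqP] := zr; rewrite subr_eq => /eqP ->; rewrite addrC FE.
rewrite /half_sign rE (negPf rN0); case: ifP => rh.
  by rewrite mul1r; congr F; lia.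
rewrite mulN1r -FN -[RHS](FE _ 1); congr F; rewrite /d in rd *; lia.
Qed.

Let dvdz_mul_small (n e : int) :
  coprimez n d%:Z -> (d%:Z %| n * e)%Z -> `|e| < d%:Z -> e = 0.
Proof.
move=> cn; rewrite Gauss_dvdzr; last by rewrite coprimez_sym.
exact: dvdz_small_eq0.
Qed.

(** For [X = x + 1] and [Y = y + 1], equal indices mean [n X = n Y] or [n X = - n Y] modulo [d].
    Cancelling [n], [d] divides [X - Y] or [X + Y]; both are less than [d] in absolute value, and
    the second is positive. *)
Lemma half_index_inj (n : int) (x y : 'I_h) : coprimez n d%:Z ->
  half_index (n * x.+1%:Z) = half_index (n * y.+1%:Z) -> x = y.
Proof.
move=> cn; rewrite /half_index.
have nd e := @dvdz_mul_small _ e cn.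
have [r -> [r0 rd xr]] := resP (n * x.+1%:Z).
have [s -> [s0 sd ys]] := resP (n * y.+1%:Z).
have lx := ltn_ord x; have ly := ltn_ord y.
have rN0 : r != 0.
  apply/negP => /eqP re; move: xr; rewrite re subr0 => /nd; rewrite /d; lia.
have sN0 : s != 0.
  apply/negP => /eqP se; move: ys; rewrite se subr0 => /nd; rewrite /d; lia.
move=> E; have [] : r = s \/ r + s = d%:Z.
  move: E rd sd; rewrite /d; case: ifP; case: ifP; lia.
- move=> rs; apply/val_inj => /=.
  have : (d%:Z %| n * (x.+1%:Z - y.+1%:Z))%Z.
    have -> : n * (x.+1%:Z - y.+1%:Z) = (n * x.+1%:Z - r) - (n * y.+1%:Z - s) by rewrite rs; ring.
    exact: rpredB.
  by move/nd; rewrite /d; lia.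
- move=> rs; apply/val_inj => /=.
  have : (d%:Z %| n * (x.+1%:Z + y.+1%:Z))%Z.
    have -> : n * (x.+1%:Z + y.+1%:Z) = (n * x.+1%:Z - r) + (n * y.+1%:Z - s) + d%:Z
      by rewrite -rs; ring.
    by do !apply: rpredD => //; rewrite -[X in X \in _]mul1r; exact: dvdz_mull (dvdzz _).
  by move/nd; rewrite /d; lia.
Qed.

Lemma coprime_half_ndvd (n : int) (x : 'I_h) :
  coprimez n d%:Z -> ~~ (d%:Z %| n * x.+1%:Z)%Z.
Proof.
move=> cn; apply/negP => /(dvdz_mul_small cn).
by have := ltn_ord x; rewrite /d; lia.
Qed.

(** Gauss's lemma: multiplication by [n] permutes [1, ..., h] up to signs, and these signs come out
    of the odd function [F]. *)
Lemma prod_half_system (F : int -> R[i]) (n : int) :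
  (forall x, F (x + d%:Z) = F x) -> (forall x, F (- x) = - F x) ->
  coprimez n d%:Z ->
  \prod_(x < h) F (n * x.+1%:Z) =
  (\prod_(x < h) half_sign (n * x.+1%:Z)) * \prod_(x < h) F x.+1%:Z.
Proof.
move=> FP FN cn.
pose rho (x : 'I_h) := Ordinal (half_index_lt (coprime_half_ndvd x cn)).
have rhoI : injective rho.
  by move=> x y /(congr1 val); apply: half_index_inj.
rewrite [X in _ = _ * X](reindex_inj rhoI) -big_split /=.
by apply: eq_bigr => x _; apply: half_indexP => //; apply: coprime_half_ndvd.
Qed.

(* By Gauss's lemma this is the Jacobi symbol [(n / d)]; taking it as the
   definition makes the value at [n] depend visibly on [d] modulo [4 n]. *)
Lemma exists_quadratic_dchar : exists xi : dirichletChar R d,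
  forall n, coprimez n d%:Z -> xi n = \prod_(x < h) half_sign (n * x.+1%:Z).
Proof.
pose f n := if coprimez n d%:Z then \prod_(x < h) half_sign (n * x.+1%:Z) else 0.
have fM m n : f (m * n) = f m * f n.
  rewrite /f coprimezMl; case: (boolP (coprimez m _)) => cm /=; last by rewrite mul0r.
  case: ifP => cn; last by rewrite mulr0.
  (* Multiplicativity is Gauss's lemma for the odd function [half_sign (m * z)] of [z]. *)
  rewrite [RHS]mulrC -(@prod_half_system (fun z => half_sign (m * z))) //.
  - by apply: eq_bigr => x _; rewrite mulrA.
  - by move=> x; apply: half_sign_eqmod; rewrite mulrDr addrAC subrr add0r dvdz_mull.
  - by move=> x; rewrite mulrN half_signN.
have fP n : f (n + d%:Z) = f n.
  rewrite /f; have -> : coprimez (n + d%:Z) d%:Z = coprimez n d%:Z.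
    by apply: coprimez_eqmod; rewrite addrAC subrr add0r dvdzz.
  case: ifP => // _; apply: eq_bigr => x _; apply: half_sign_eqmod.
  by rewrite mulrDl addrAC subrr add0r dvdz_mulr.
have fN0 n : (f n != 0) = coprimez n d%:Z.
  rewrite /f; case: ifP => cn; last by rewrite eqxx.
  by apply/prodf_neq0 => x _; rewrite half_sign_neq0 coprime_half_ndvd.
exists (DirichletChar (ltn0Sn _ : (0 < d)%N) fM fP fN0) => n cn /=.
by rewrite /f cn.
Qed.

Lemma half_sign_pm1 z : half_sign z = 0 \/ half_sign z ^+ 2 = 1.
Proof.
rewrite /half_sign; case: ifP; [by left|right].
by case: ifP; rewrite ?sqrrN expr1n.
Qed.

End GaussLemma.

(** Each block of [k] consecutive indices shares one sign, whose [k]-th power is 1. *)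
Lemma prod_block_sign (A : comRingType) (k n : nat) : (0 < k)%N -> ~~ odd k ->
  \prod_(x < n * k) ((-1) ^+ (x %/ k) : A) = 1.
Proof.
move=> k0 ek; elim: n => [|n IHn]; first by rewrite mul0n big_ord0.
rewrite mulSnr big_split_ord /= IHn mul1r.
under eq_bigr => x _ do rewrite divnMDl // divn_small ?addn0 //.
by rewrite prodr_const card_ord -exprM -signr_odd oddM (negPf ek) andbF expr0.
Qed.

(** With [4 A - 1 = 2 h + 1], the number [h = 2 A - 1] of signs is odd, whence the value at [-1]. If
    [A = n k], the sign of [n X] flips whenever [X] reaches a multiple of [2 k], so the signs come
    in blocks of even length. *)
Lemma quadratic_dchar_residues (R : rcfType) (A : nat) : (0 < A)%N ->
  exists2 xi : dirichletChar R (4 * A).-1,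
    xi (-1) = -1 /\ forall n, coprimez n (4 * A).-1%:Z -> xi n ^+ 2 = 1 &
    forall n : nat, (n %| A)%N -> xi n%:Z = 1.
Proof.
move=> A0; pose h := (2 * A).-1.
have dE : (4 * A).-1 = h.*2.+1 by rewrite /h; lia.
rewrite dE.
have [xi xiE] := exists_quadratic_dchar R h; exists xi.
  split=> [|n cn].
    rewrite xiE; last by rewrite coprimezE /= coprime1n.
    have sN (x : 'I_h) : half_sign R h (-1 * x.+1%:Z) = -1.
      by rewrite mulN1r half_signN half_sign_small //; have := ltn_ord x; lia.
    rewrite (eq_bigr (fun=> -1)) //.
    have oh : odd h by rewrite /h; lia.
    by rewrite prodr_const card_ord -signr_odd oh.
  rewrite xiE // -prodrXl big1 // => x _.
  case: (half_sign_pm1 R h (n * x.+1%:Z)) => // s0.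
  by have := coprime_half_ndvd x cn; rewrite -(half_sign_neq0 R) s0 eqxx.
move=> n nA; have n0 : (0 < n)%N by apply: dvdn_gt0 nA.
have [k Ak] := dvdnP nA.
have k0 : (0 < k)%N by move: A0; rewrite Ak muln_gt0 => /andP[].
rewrite xiE; last first.
  rewrite -dE coprimezE; apply: (@coprime_dvdl _ (4 * A)).
    by rewrite dvdn_mull.
  by rewrite coprimenP // muln_gt0.
rewrite -[RHS](@prod_block_sign R[i] (2 * k) n); [|by lia|by rewrite mul2n odd_double].
have -> : (n * (2 * k) = h.+1)%N by rewrite /h Ak; lia.
(* The index 0, of sign 1, completes [1, ..., h] to [n] full blocks of length [2 k]. *)
rewrite big_ord_recl /= div0n expr0 mul1r; apply: eq_bigr => x _ /=.
have xh := ltn_ord x.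
set X := x.+1; rewrite /bump /= add1n -/X.
(* With [X = a (2 k) + r] one has [2 n X = a d + (a + 2 n r)] and [a + 2 n r < d],
   so the parity of [a] tells in which half of the residues [n X] falls. *)
have XE := divn_eq X (2 * k); have Xr : (X %% (2 * k) < 2 * k)%N by rewrite ltn_mod; lia.
have X0 : (0 < X <= h)%N by [].
move: (X %/ (2 * k))%N (X %% (2 * k))%N XE Xr => a r XE Xr.
have hE : h = (2 * n * k).-1 by rewrite /h Ak; lia.
have an : (a < n)%N by nia.
have aE := odd_double_half a; set b := a./2 in aE *.
case: (boolP (odd a)) aE => oa aE; rewrite -signr_odd ?oa ?(negPf oa) ?expr1 ?expr0.
  rewrite -(half_sign_large R (h := h) (z := (h + b + 1 + n * r)%:Z)); last by nia.
  apply: half_sign_eqmod; apply/dvdzP; exists b%:Z; nia.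
rewrite -(half_sign_small R (h := h) (z := (b + n * r)%:Z)); last by nia.
apply: half_sign_eqmod; apply/dvdzP; exists b%:Z; nia.
Qed.

(** * The primitive character imitating [psi] *)

Lemma dchar_product (R : rcfType) (m d : nat) (psi : dirichletChar R m)
    (xi : dirichletChar R d) :
  exists chi : dirichletChar R (m * d), forall n, chi n = psi n * xi n.
Proof.
have md0 : (0 < m * d)%N by rewrite muln_gt0 !(dchar_modulus_gt0 psi, dchar_modulus_gt0 xi).
pose f n := psi n * xi n.
have fM n k : f (n * k) = f n * f k by rewrite /f !dcharM mulrACA.
have fP n : f (n + (m * d)%:Z) = f n.
  rewrite /f PoszM; congr (_ * _); apply: dchar_eqmod.
    by rewrite addrAC subrr add0r dvdz_mulr ?dvdzz.
  by rewrite addrAC subrr add0r dvdz_mull ?dvdzz.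
have fN0 n : (f n != 0) = coprimez n (m * d)%:Z.
  by rewrite PoszM coprimezMr mulf_eq0 negb_or !dchar_neq0.
by exists (DirichletChar md0 fM fP fN0).
Qed.

(** The [g]-th power kills [xi] because [g] is even; no smaller positive power of [chi] is
    principal, because [m <= y] lets all values of [psi] be read off from [chi] on [1, ..., y]. *)
Lemma exists_pretentious_dchar (R : rcfType) (g m y : nat) (psi : dirichletChar R m) :
  ~~ odd g -> has_order psi g -> (1 < m <= y)%N ->
  exists (q : nat) (chi : dirichletChar R q),
    [/\ primitive chi, has_order chi g, (q <= m * (4 * y`!))%N, (y < m * q)%N &
      forall k : nat, (0 < k <= y)%N -> coprime k m ->
        chi k%:Z = psi k%:Z /\ chi (- k%:Z) = - psi (- k%:Z)].
Proof.
move=> g_even psig /andP[m1 my].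
have A0 := fact_gt0 y.
have [xi [xiN xi2] xi1] := quadratic_dchar_residues R A0.
set d := (4 * y`!).-1 in xi xiN xi2 xi1 *.
have [chi0 chi0E] := dchar_product psi xi.
have [q [chi [prim [qQ chiE]]]] := exists_primitive_inducing chi0.
have xik (k : nat) : (0 < k <= y)%N -> xi k%:Z = 1.
  by move=> ky; apply: xi1; apply: dvdn_fact.
have cop (k : nat) : (0 < k <= y)%N -> coprime k m -> coprimez k%:Z (m * d)%:Z.
  move=> ky km; rewrite PoszM coprimezMr -(dchar_neq0 xi) xik // oner_eq0 andbT.
  by rewrite coprimezE.
have vals (k : nat) : (0 < k <= y)%N -> coprime k m ->
    chi k%:Z = psi k%:Z /\ chi (- k%:Z) = - psi (- k%:Z).
  move=> ky km; have ck := cop k ky km.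
  rewrite -!chiE ?coprimeNz // !chi0E xik // mulr1; split=> //.
  have -> : xi (- k%:Z) = -1 by rewrite -[- k%:Z]mulN1r dcharM xik // mulr1.
  by rewrite mulrN1.
have q0 := dchar_modulus_gt0 chi.
have g0 := has_order_pos psig.
have chi_g n : coprimez n q%:Z -> chi n ^+ g = 1.
  (* [chi] is known to equal [psi xi] at integers prime to [m d], so [n] is first moved to such an
     integer within its class modulo [q]. *)
  move=> cn; have [n' nn' cn'] := lift_coprime (dchar_modulus_gt0 chi0) cn.
  rewrite -(dchar_eqmod chi nn') -chiE // chi0E exprMn.
  move: cn'; rewrite PoszM coprimezMr => /andP[cm cd].
  rewrite (has_order_expr psig cm) mul1r -[g]even_halfK // -mul2n exprM.
  by rewrite xi2 // expr1n.
exists q, chi; split=> //.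
- split=> // [n|j j0 kj].
    rewrite /principal_fun; case: (boolP (coprimez n q%:Z)) => cn; first exact: chi_g.
    by rewrite (dchar_eq0 _ cn) expr0n gtn_eqF.
  have [_ _ minpsi] := psig; apply: minpsi => // n.
  rewrite /principal_fun; case: (boolP (coprimez n m%:Z)) => cn; last first.
    by rewrite (dchar_eq0 _ cn) expr0n gtn_eqF.
  (* The least residue [r] of [n] is below [m], hence at most [y], where [chi] and [psi] agree. *)
  pose r := `|(n %% m%:Z)%Z|%N.
  have rE : r%:Z = (n %% m%:Z)%Z by rewrite /r gez0_abs // modz_ge0 //; lia.
  have nr : (m%:Z %| n - r%:Z)%Z by rewrite -eqz_mod_dvd rE modz_mod.
  have cr : coprime r m by move: cn; rewrite (coprimez_eqmod nr).
  have rm : (r < m)%N by rewrite -ltz_nat rE ltz_pmod //; lia.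
  have r0 : (0 < r)%N.
    by case: (r) cr => //; rewrite /coprime gcd0n => /eqP m1'; rewrite m1' in m1.
  have ry : (0 < r <= y)%N by lia.
  have [psir _] := vals r ry cr.
  rewrite (dchar_eqmod psi nr) -psir kj /principal_fun.
  by rewrite (coprimez_dvdr qQ (cop r ry cr)).
- apply: leq_trans (dvdn_leq (dchar_modulus_gt0 chi0) qQ) _.
  by rewrite leq_pmul2l ?leq_pred // ltnW.
(* If [m q <= y], evaluate [chi] at [m q - 1 <= y], which is [- 1] mod [m] and mod [q]. *)
- rewrite ltnNge; apply/negP => qy.
  pose k := (m * q).-1.
  have kE : k%:Z = (m * q)%:Z - 1 by rewrite /k; lia.
  have ky : (0 < k <= y)%N by rewrite /k; lia.
  have km : coprime k m.
    apply: (@coprime_dvdr _ (m * q)); first exact: dvdn_mulr.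
    by rewrite coprimePn // muln_gt0 q0; lia.
  have [ck _] := vals k ky km.
  have y1 : (0 < 1 <= y)%N by lia.
  have [_] := vals 1 y1 (coprime1n m).
  have -> : chi (- 1) = chi k.
    apply: dchar_eqmod; rewrite kE PoszM.
    have -> : -1 - (m%:Z * q%:Z - 1) = - (m%:Z) * q%:Z by ring.
    by rewrite dvdz_mull ?dvdzz.
  have -> : psi (- 1) = psi k.
    apply: dchar_eqmod; rewrite kE PoszM.
    have -> : -1 - (m%:Z * q%:Z - 1) = m%:Z * - q%:Z by ring.
    by rewrite dvdz_mulr ?dvdzz.
  move/eqP; rewrite ck -subr_eq0 opprK -mulr2n mulrn_eq0 /=.
  by apply/negP; rewrite dchar_neq0 coprimezE.
Qed.

(** * Fourier analysis modulo [q] *)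

Lemma exprz_opp (F : fieldType) (x : F) (k : int) : x ^ (- k) = (x ^ k)^-1.
Proof. by rewrite expfV exprz_inv. Qed.

Lemma exprzM_expr (F : fieldType) (x y : F) (k : int) (s t : nat) :
  (x ^ k) ^+ s * (y ^ k) ^+ t = (x ^+ s * y ^+ t) ^ k.
Proof. by rewrite expfzMl; congr (_ * _); rewrite exprnP exprzAC. Qed.

Section FiniteFourier.
Variables (C : numClosedFieldType) (q : nat) (w : C).
Hypothesis wq : q.-primitive_root w.

Lemma prim_root_norm : `|w| = 1.
Proof.
have q0 := prim_order_gt0 wq.
apply/eqP; rewrite -(pexpr_eq1 q0) ?normr_ge0 // -normrX.
by rewrite (prim_expr_order wq) normr1.
Qed.

Lemma prim_root_neq0 : w != 0.
Proof. by rewrite -normr_eq0 prim_root_norm oner_eq0. Qed.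

Lemma conj_norm1 (v : C) : `|v| = 1 -> v^* = v^-1.
Proof.
move=> v1; have v0 : v != 0 by rewrite -normr_eq0 v1 oner_eq0.
by apply: (mulfI v0); rewrite -normCK v1 expr1n divff.
Qed.

Lemma prim_root_exprz_eq1 (k : int) : (w ^ k == 1) = (q%:Z %| k)%Z.
Proof.
case: k => k; first by rewrite -exprnP -(prim_order_dvd wq) dvdzE.
by rewrite NegzE exprz_opp invr_eq1 -exprnP -(prim_order_dvd wq) dvdzE abszN.
Qed.

Lemma prim_root_exprz_eq (k l : int) : (q%:Z %| k - l)%Z -> w ^ k = w ^ l.
Proof.
rewrite -prim_root_exprz_eq1 expfzDr ?prim_root_neq0 // exprz_opp => /eqP kl.
by rewrite -[RHS]mul1r -kl mulfVK // expfz_neq0 // prim_root_neq0.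
Qed.

Lemma sum_prim_root (k : int) :
  \sum_(t < q) (w ^ k) ^+ t = if (q%:Z %| k)%Z then q%:R else 0.
Proof.
rewrite -prim_root_exprz_eq1; case: eqVneq => [->|wk].
  by under eq_bigr do rewrite expr1n; rewrite sumr_const card_ord.
apply: (mulfI (_ : w ^ k - 1 != 0)); first by rewrite subr_eq0.
rewrite -subrX1 mulr0 exprnP exprzAC -exprnP.
by rewrite (prim_expr_order wq) exp1rz subrr.
Qed.

Lemma parseval (a : 'I_q -> C) :
  \sum_(t < q) `|\sum_(j < q) a j * w ^+ (t * j)| ^+ 2 =
  q%:R * \sum_(j < q) `|a j| ^+ 2.
Proof.
have w0 := prim_root_neq0.
have termE (t : 'I_q) : `|\sum_(j < q) a j * w ^+ (t * j)| ^+ 2 =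
    \sum_(j < q) \sum_(k < q) a j * (a k)^* * (w ^ (j%:Z - k%:Z)) ^+ t.
  rewrite normCK rmorph_sum mulr_suml; apply: eq_bigr => j _.
  rewrite mulr_sumr; apply: eq_bigr => k _.
  rewrite rmorphM rmorphXn /= (conj_norm1 prim_root_norm) expfzDr // exprz_opp.
  by rewrite mulnC [(t * k)%N]mulnC !exprM exprMn -!exprnP !exprVn mulrACA.
under eq_bigr => t _ do rewrite termE.
rewrite exchange_big mulr_sumr /=; apply: eq_bigr => j _.
rewrite exchange_big /= (bigD1 j) //= [X in _ + X]big1 => [|k kj].
  under eq_bigr do rewrite subrr expr0z expr1n mulr1.
  by rewrite addr0 sumr_const card_ord normCK mulr_natl.
rewrite -mulr_sumr sum_prim_root ifF ?mulr0 //.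
apply/negP => /dvdz_small_eq0 E; move/eqP: kj; apply; apply/val_inj => /=; move: E.
have := ltn_ord j; have := ltn_ord k; lia.
Qed.

(** Parseval for the coefficients [v ^+ j], [j < N], extended by zero up to [q]: this is the total
    mass of a translated Fejer kernel. *)
Lemma fejer (N : nat) (v : C) : (N <= q)%N -> `|v| = 1 ->
  \sum_(t < q) `|\sum_(j < N) (w ^+ t * v) ^+ j| ^+ 2 = (q * N)%:R.
Proof.
move=> Nq v1; pose a (j : 'I_q) := if (j < N)%N then v ^+ j else 0.
have := parseval a.
have -> : \sum_(j < q) `|a j| ^+ 2 = N%:R.
  rewrite (eq_bigr (fun j : 'I_q => if (j < N)%N then 1 else 0)); last first.
    move=> j _; rewrite /a; case: ifP => _; last by rewrite normr0 expr0n.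
    by rewrite normrX v1 !expr1n.
  by rewrite -big_mkcond (big_ord_narrow Nq) /= sumr_const card_ord.
rewrite natrM => <-; apply: eq_bigr => t _; congr (`| _ | ^+ 2).
transitivity (\sum_(j < q | (j < N)%N) a j * w ^+ (t * j)).
  rewrite (big_ord_narrow Nq); apply: eq_bigr => j _.
  by rewrite /a /= ltn_ord exprMn mulrC exprM.
rewrite big_mkcond; apply: eq_bigr => j _; rewrite /a; case: (boolP (j < N)%N) => // _.
by rewrite mul0r.
Qed.

(** Fourier inversion modulo [q]; each coefficient is an average of [q] numbers of modulus at most
    1. *)
Lemma periodic_expansion (f : int -> C) :
  (forall x y, (q%:Z %| x - y)%Z -> f x = f y) -> (forall x, `|f x| <= 1) ->
  exists2 b : 'I_q -> C, forall a, `|b a| <= 1 &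
    forall k, f k = \sum_(a < q) b a * (w ^ k) ^+ a.
Proof.
move=> fP f1; have w0 := prim_root_neq0; have q0 := prim_order_gt0 wq.
have qC0 : q%:R != 0 :> C by rewrite pnatr_eq0 -lt0n.
exists (fun a => q%:R^-1 * \sum_(r < q) f r%:Z * (w ^ (- r%:Z)) ^+ a).
  move=> a; rewrite normrM normfV normr_nat mulrC ler_pdivrMr ?ltr0n // mul1r.
  apply: le_trans (ler_norm_sum _ _ _) _.
  have : \sum_(r < q) `|f r%:Z * (w ^ (- r%:Z)) ^+ a| <= \sum_(r < q) (1 : C).
    apply: ler_sum => r _; rewrite normrM normrX.
    by rewrite exprz_opp normfV -exprnP normrX prim_root_norm expr1n invr1 expr1n mulr1.
  by rewrite sumr_const card_ord.
move=> k.
under eq_bigr => a _ do rewrite -mulrA mulr_suml.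
rewrite -mulr_sumr exchange_big /=.
have r0P : (`|(k %% q%:Z)%Z| < q)%N.
  by rewrite -ltz_nat gez0_abs ?modz_ge0 ?ltz_pmod //; lia.
pose r0 := Ordinal r0P.
have r0E : r0%:Z = (k %% q%:Z)%Z by rewrite /= gez0_abs // modz_ge0 //; lia.
have kr0 : (q%:Z %| k - r0%:Z)%Z by rewrite -eqz_mod_dvd r0E modz_mod.
have inner (r : 'I_q) : \sum_(a < q) f r%:Z * (w ^ (- r%:Z)) ^+ a * (w ^ k) ^+ a =
    f r%:Z * (if (q%:Z %| k - r%:Z)%Z then q%:R else 0).
  rewrite -sum_prim_root mulr_sumr; apply: eq_bigr => a _.
  by rewrite -mulrA -exprMn expfzDr // [w ^ _ * _]mulrC.
under eq_bigr => r _ do rewrite inner.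
rewrite (bigD1 r0) //= -/r0 kr0 [X in _ + X]big1 => [|r rr0].
  by rewrite addr0 mulrCA mulVf // mulr1; apply: fP.
rewrite ifF ?mulr0 //; apply/negP => kr; move/eqP: rr0; apply; apply/ord_inj.
have : (q%:Z %| r%:Z - r0%:Z)%Z.
  have -> : r%:Z - r0%:Z = (k - r0%:Z) - (k - r%:Z) by ring.
  exact: rpredB.
move/dvdz_small_eq0; have := ltn_ord r; have := ltn_ord r0.
move: (nat_of_ord r) (nat_of_ord r0) => x y xq yq E.
by have := E ltac:(lia); lia.
Qed.

End FiniteFourier.

Lemma summation_by_parts (A : comRingType) (a : nat -> A) (z : A) (Q : nat) :
  (1 - z) * \sum_(t < Q) (\sum_(n < t.+1) a n) * z ^+ t =
  \sum_(n < Q) a n * z ^+ n - (\sum_(n < Q) a n) * z ^+ Q.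
Proof.
elim: Q => [|Q IHQ]; first by rewrite !big_ord0 mulr0 mul0r subr0.
rewrite big_ord_recr mulrDr IHQ /= ![in RHS]big_ord_recr /= [in LHS]big_ord_recr /= exprS.
ring.
Qed.

Lemma reindex_residues (A : nmodType) (q : nat) (F : int -> A) (k : int) :
  (0 < q)%N -> coprimez k q%:Z ->
  (forall x y, (q%:Z %| x - y)%Z -> F x = F y) ->
  \sum_(n < q) F n%:Z = \sum_(n < q) F (k * n%:Z).
Proof.
move=> q0 ck FP.
have rhoP (n : 'I_q) : (`|(k * n%:Z %% q%:Z)%Z| < q)%N.
  by rewrite -ltz_nat gez0_abs ?modz_ge0 ?ltz_pmod //; lia.
pose rho n := Ordinal (rhoP n).
have rhoE n : (q%:Z %| (rho n)%:Z - k * n%:Z)%Z.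
  by rewrite -eqz_mod_dvd /= gez0_abs ?modz_ge0 ?modz_mod //; lia.
have rhoI : injective rho.
  move=> x y xy; apply: ord_inj.
  have : (q%:Z %| k * (x%:Z - y%:Z))%Z.
    have -> : k * (x%:Z - y%:Z) = ((rho y)%:Z - k * y%:Z) - ((rho x)%:Z - k * x%:Z).
      by rewrite xy; ring.
    exact: rpredB.
  rewrite Gauss_dvdzr; last by rewrite coprimez_sym.
  move/dvdz_small_eq0 => E; have := ltn_ord x; have := ltn_ord y.
  by move: (nat_of_ord x) (nat_of_ord y) E => a b E aq bq; have := E ltac:(lia); lia.
rewrite (reindex_inj rhoI); apply: eq_bigr => n _; exact: FP.
Qed.

(** * Gauss sums and the Fejer kernel test *)

Section GaussSum.
Variables (R : rcfType) (q : nat) (chi : dirichletChar R q) (w : R[i]).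
Hypotheses (wq : q.-primitive_root w) (prim : primitive chi) (q1 : (1 < q)%N).

Definition gauss_sum (k : int) : R[i] := \sum_(n < q) chi n%:Z * (w ^ k) ^+ n.

Lemma gauss_sum_coprime (k : int) :
  coprimez k q%:Z -> chi k * gauss_sum k = gauss_sum 1.
Proof.
move=> ck; pose F (n : int) := chi n * w ^ n.
have FP x y : (q%:Z %| x - y)%Z -> F x = F y.
  by move=> xy; rewrite /F (dchar_eqmod chi xy) (prim_root_exprz_eq wq xy).
transitivity (\sum_(n < q) F n%:Z); last first.
  by apply: eq_bigr => n _; rewrite /F expr1z -exprnP.
rewrite (reindex_residues (ltnW q1) ck FP) mulr_sumr; apply: eq_bigr => n _.
by rewrite /F dcharM mulrA exprnP exprz_exp.
Qed.

(** Let [e = gcd (k, q) > 1]. If [c = 1] modulo [q / e], replacing [n] by [c n] leaves [w ^ (k n)]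
    unchanged and multiplies the sum by [chi c]. A nonzero sum would thus make [chi] descend to the
    modulus [q / e], against primitivity. *)
Lemma gauss_sum_ncoprime (k : int) : ~~ coprimez k q%:Z -> gauss_sum k = 0.
Proof.
move=> nck; apply/eqP; apply: contraT => G0; exfalso.
have q0 : (0 < q)%N := ltnW q1.
pose e := gcdn `|k| q; pose d := (q %/ e)%N.
have e0 : (0 < e)%N by rewrite gcdn_gt0 q0 orbT.
have e1 : (1 < e)%N.
  move: e0; rewrite leq_eqVlt => /orP[/eqP e1|//].
  by case/negP: nck; rewrite coprimezE /coprime -[gcdn _ _]/e -e1.
have qE : q = (d * e)%N by rewrite divnK // dvdn_gcdr.
have dq : (d < q)%N by rewrite ltn_Pdiv.
have [|c cc cd|psi] := @descent R q d chi; first by rewrite qE dvdn_mulr.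
  apply: (mulIf G0); rewrite mul1r.
  pose F (n : int) := chi n * w ^ (k * n).
  have FP x y : (q%:Z %| x - y)%Z -> F x = F y.
    move=> xy; rewrite /F (dchar_eqmod chi xy); congr (_ * _).
    by apply: (prim_root_exprz_eq wq); rewrite -mulrBr dvdz_mull.
  have GE : gauss_sum k = \sum_(n < q) F n%:Z.
    by apply: eq_bigr => n _; rewrite /F exprnP exprz_exp.
  rewrite [RHS]GE (reindex_residues q0 cc FP) GE mulr_sumr.
  apply: eq_bigr => n _; rewrite /F dcharM -mulrA; congr (_ * (_ * _)).
  apply: (prim_root_exprz_eq wq).
  have -> : k * n%:Z - k * (c * n%:Z) = - ((c - 1) * k) * n%:Z by ring.
  rewrite dvdz_mulr // rpredN qE PoszM dvdz_mul //.
  by rewrite dvdzE dvdn_gcdl.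
exact: prim dq.
Qed.

Lemma gauss_sum0 : \sum_(n < q) chi n%:Z = 0.
Proof.
rewrite -[RHS](@gauss_sum_ncoprime 0); last first.
  by rewrite coprimezE /coprime gcd0n; lia.
by apply: eq_bigr => n _; rewrite expr0z expr1n mulr1.
Qed.

Hypothesis chi1 : forall n, coprimez n q%:Z -> `|chi n| = 1.

(** Parseval for [chi]: the transform at [t] has modulus [|chi t|] times that of [gauss_sum 1], so
    the sum of [|chi n| ^ 2] cancels from both sides. *)
Lemma gauss_sum_norm : `|gauss_sum 1| ^+ 2 = q%:R.
Proof.
have S0 : \sum_(n < q) `|chi n%:Z| ^+ 2 != 0.
  rewrite gt_eqF // (bigD1 (Ordinal q1)) //= dchar1 normr1 expr1n.
  by rewrite ltr_pwDl // sumr_ge0 // => i _; rewrite exprn_ge0.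
apply: (mulIf S0); rewrite -(parseval wq (fun n => chi n%:Z)) mulr_sumr.
apply: eq_bigr => t _.
have -> : \sum_(j < q) chi j%:Z * w ^+ (t * j) = gauss_sum t.
  by apply: eq_bigr => j _; rewrite -exprnP -exprM.
case: (boolP (coprimez t q%:Z)) => ct; last first.
  by rewrite (gauss_sum_ncoprime ct) (dchar_eq0 chi ct) normr0 expr0n mulr0.
by rewrite -(gauss_sum_coprime ct) !normrM chi1 // mul1r expr1n mulr1.
Qed.

(** Summation by parts; the boundary term is a sum of [chi] over a full period, which vanishes. *)
Lemma partial_sum_transform (k : int) : ~~ (q%:Z %| k)%Z ->
  \sum_(t < q) (\sum_(n < t.+1) chi n%:Z) * (w ^ k) ^+ t =
  gauss_sum k / (1 - w ^ k).
Proof.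
move=> qk; have wk : 1 - w ^ k != 0.
  by rewrite subr_eq0 eq_sym (prim_root_exprz_eq1 wq).
apply: (mulfI wk); rewrite (summation_by_parts (fun n => chi n%:Z)).
by rewrite gauss_sum0 mul0r subr0 mulrCA divff // mulr1.
Qed.

Variables (m : nat) (psi : dirichletChar R m) (z : R[i]) (N : nat) (M : R[i]).
Hypotheses (zm : m.-primitive_root z) (m1 : (1 < m)%N) (Nq : (N <= q)%N).
Hypothesis psi1 : forall n, coprimez n m%:Z -> `|psi n| = 1.
Hypothesis sumM : forall t : 'I_q, `|\sum_(n < t.+1) chi n%:Z| <= M.

Let psi0 : psi 0 = 0.
Proof. by apply: dchar_eq0; rewrite coprimezE /coprime gcd0n; lia. Qed.

(** After the expansion of [psi] over [a < m], each [a] contributes the pairing of the partial sums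
    with a nonnegative kernel of mass [q N], hence at most [q N M]. *)
Lemma fejer_test :
  `|\sum_(i < N) \sum_(j < N)
      psi (i%:Z - j%:Z) * (gauss_sum (i%:Z - j%:Z) / (1 - w ^ (i%:Z - j%:Z)))|
  <= (m * (q * N))%:R * M.
Proof.
have w0 := prim_root_neq0 wq; have z0 := prim_root_neq0 zm.
have psiP x y : (m%:Z %| x - y)%Z -> psi x = psi y by apply: dchar_eqmod.
have psile x : `|psi x| <= 1.
  case: (boolP (coprimez x m%:Z)) => cx; first by rewrite psi1.
  by rewrite (dchar_eq0 psi cx) normr0.
have [b b1 bE] := periodic_expansion zm psiP psile.
pose S (t : 'I_q) := \sum_(n < t.+1) chi n%:Z.
pose K (a : 'I_m) (t : 'I_q) := `|\sum_(j < N) (w ^+ t * z ^+ a) ^+ j| ^+ 2.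
have -> : \sum_(i < N) \sum_(j < N)
      psi (i%:Z - j%:Z) * (gauss_sum (i%:Z - j%:Z) / (1 - w ^ (i%:Z - j%:Z)))
    = \sum_(a < m) \sum_(t < q) b a * (S t * K a t).
  transitivity (\sum_(i < N) \sum_(j < N) \sum_(a < m) \sum_(t < q)
      b a * (S t * (w ^+ t * z ^+ a) ^ (i%:Z - j%:Z))).
    apply: eq_bigr => i _; apply: eq_bigr => j _.
    transitivity (psi (i%:Z - j%:Z) * \sum_(t < q) S t * (w ^ (i%:Z - j%:Z)) ^+ t).
      (* On the diagonal the denominator [1 - w ^ 0] is zero, but [psi 0 = 0] kills both sides;
         elsewhere [|i - j| < N <= q] keeps it nonzero. *)
      case: (eqVneq i j) => [->|ij]; first by rewrite subrr psi0 !mul0r.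
      rewrite partial_sum_transform //; apply/negP => /dvdz_small_eq0 E.
      move/eqP: ij; apply; apply: ord_inj; have := ltn_ord i; have := ltn_ord j.
      by move: (nat_of_ord i) (nat_of_ord j) E => x y E xN yN; have := E ltac:(lia); lia.
    rewrite bE mulr_suml; apply: eq_bigr => a _; rewrite -mulrA !mulr_sumr.
    apply: eq_bigr => t _; congr (_ * _); rewrite mulrCA; congr (_ * _); rewrite mulrC.
    exact: exprzM_expr.
  under eq_bigr => i _ do rewrite exchange_big.
  rewrite exchange_big /=; apply: eq_bigr => a _.
  under eq_bigr => i _ do rewrite exchange_big.
  rewrite exchange_big /=; apply: eq_bigr => t _.
  under eq_bigr => i _ do rewrite -mulr_sumr -mulr_sumr.
  rewrite -!mulr_sumr; congr (_ * (_ * _)); rewrite /K normCK rmorph_sum /= mulr_suml.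
  have v1 : `|w ^+ t * z ^+ a| = 1.
    by rewrite normrM !normrX (prim_root_norm wq) (prim_root_norm zm) !expr1n mul1r.
  have v0 : w ^+ t * z ^+ a != 0 by rewrite -normr_eq0 v1 oner_eq0.
  apply: eq_bigr => i _; rewrite mulr_sumr; apply: eq_bigr => j _.
  by rewrite rmorphXn /= (conj_norm1 v1) expfzDr // exprz_opp -!exprnP exprVn.
have K0 a t : 0 <= K a t by rewrite exprn_ge0.
have boundA (a : 'I_m) : `|\sum_(t < q) b a * (S t * K a t)| <= (q * N)%:R * M.
  have za1 : `|z ^+ a| = 1 by rewrite normrX (prim_root_norm zm) expr1n.
  rewrite -mulr_sumr normrM -[leRHS]mul1r ler_pM //.
  rewrite -(fejer wq Nq za1) mulr_suml.
  apply: le_trans (ler_norm_sum _ _ _) _; apply: ler_sum => t _.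
  rewrite normrM (ger0_norm (K0 a t)) [leLHS]mulrC.
  exact: ler_wpM2l (K0 a t) _ _ (sumM t).
apply: le_trans (ler_norm_sum _ _ _) _.
apply: le_trans (ler_sum _ (fun a _ => boundA a)) _.
by rewrite sumr_const card_ord -[leLHS]mulr_natl [in leRHS]natrM mulrA.
Qed.

Hypothesis sameE : forall k : nat, (0 < k < N)%N -> coprime k m ->
  chi k%:Z = psi k%:Z /\ chi (- k%:Z) = - psi (- k%:Z).
Variable kappa : nat -> R.
Hypothesis kappa0 : forall k, (0 < k < N)%N -> 0 <= kappa k.
Hypothesis kappaE : forall k, (0 < k < N)%N ->
  (1 + w ^+ k) / (1 - w ^+ k) = 'i * (kappa k)%:C%C.

(** [psi k * gauss_sum k] is [gauss_sum 1], and its value at [- k] is the opposite. With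
    [x = w ^+ k], the identity [1 / (1 - x) - 1 / (1 - x^-1) = (1 + x) / (1 - x)] then produces
    [kappa k]. *)
Lemma fejer_lower_bound :
  `|gauss_sum 1| *
    (\sum_(i < N) \sum_(j < N) if (j < i)%N && coprime (i - j) m
       then kappa (i - j) else 0)%:C%C <= (m * (q * N))%:R * M.
Proof.
have w0 := prim_root_neq0 wq.
pose T (i j : nat) := psi (i%:Z - j%:Z) * (gauss_sum (i%:Z - j%:Z) / (1 - w ^ (i%:Z - j%:Z))).
pose D (i j : nat) : R := if (j < i)%N && coprime (i - j) m then kappa (i - j) else 0.
have TD0 i j : (j < i)%N -> (i < N)%N ->
    T i j + T j i = gauss_sum 1 * ('i * (D i j)%:C%C).
  move=> ji iN; rewrite /T /D ji /=.
  have -> : j%:Z - i%:Z = - (i%:Z - j%:Z) by rewrite opprB.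
  have -> : i%:Z - j%:Z = (i - j)%N by rewrite subzn // ltnW.
  have kN : (0 < i - j < N)%N by lia.
  move: (i - j)%N kN => k kN.
  case: (boolP (coprime k m)) => km; last first.
    rewrite !(@dchar_eq0 _ _ psi) ?coprimeNz ?coprimezE //.
    by rewrite !mul0r addr0 rmorph0 !mulr0.
  have [c1 c2] := sameE kN km.
  (* Coprimality to [q] comes from [chi k = psi k], which is nonzero as [k] is prime to [m]. *)
  have cq : coprimez k%:Z q%:Z by rewrite -(dchar_neq0 chi) c1 dchar_neq0 coprimezE.
  rewrite -kappaE // exprz_opp -exprnP !mulrA -c1 gauss_sum_coprime //.
  have -> : psi (- k%:Z) = - chi (- k%:Z) by rewrite c2 opprK.
  rewrite mulNr gauss_sum_coprime ?coprimeNz //.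
  have u0 : w ^+ k != 0 by rewrite expf_neq0.
  have u1 : 1 - w ^+ k != 0.
    rewrite subr_eq0 eq_sym -(prim_order_dvd wq) gtnNdvd //; first by lia.
    by apply: leq_trans Nq; lia.
  have u2 : w ^+ k - 1 != 0 by rewrite -opprB oppr_eq0.
  by field; rewrite u0 u1 u2.
(* The sum is symmetrised in [i] and [j] so that [k = i - j] meets [- k]. *)
have TT : (\sum_(i < N) \sum_(j < N) T i j) *+ 2 =
    \sum_(i < N) \sum_(j < N) (T i j + T j i).
  rewrite mulr2n [X in _ + X]exchange_big -big_split; apply: eq_bigr => i _.
  by rewrite -big_split.
have TD i j : (i < N)%N -> (j < N)%N ->
    T i j + T j i = gauss_sum 1 * ('i * (D i j + D j i)%:C%C).
  move=> iN jN; case: (ltngtP i j) => ij.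
  - rewrite addrC TD0 // [D i j]/D ifF ?add0r //.
    by rewrite ltnNge ltnW.
  - rewrite TD0 // [D j i]/D ifF ?addr0 //.
    by rewrite ltnNge ltnW.
  - by rewrite ij /T /D subrr psi0 ltnn /= !mul0r !addr0 !mulr0.
have D0 i j : (i < N)%N -> 0 <= D i j.
  by move=> iN; rewrite /D; case: ifP => // /andP[ji _]; apply: kappa0; lia.
have TE : \sum_(i < N) \sum_(j < N) T i j =
    gauss_sum 1 * ('i * (\sum_(i < N) \sum_(j < N) D i j)%:C%C).
  apply: (mulIf (_ : 2%:R != 0)); first by rewrite pnatr_eq0.
  rewrite !mulr_natr TT -!mulrnAr -rmorphMn mulr2n [X in _ + X]exchange_big.
  rewrite -big_split rmorph_sum !mulr_sumr; apply: eq_bigr => i _.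
  rewrite -big_split rmorph_sum !mulr_sumr; apply: eq_bigr => j _.
  exact: TD.
have SD0 : 0 <= \sum_(i < N) \sum_(j < N) D i j.
  by apply: sumr_ge0 => i _; apply: sumr_ge0 => j _; apply: D0.
by have := fejer_test; rewrite TE !normrM normCi mul1r [X in _ * X]ger0_norm ?ler0c.
Qed.
End GaussSum.

(** * Cotangents at roots of unity *)

Section Trigonometry.
Import numFieldNormedType.Exports.
Variable R : realType.
Implicit Types (x : R) (n k : nat).

Lemma sin_le_id x : 0 <= x -> sin x <= x.
Proof.
move=> x0; have [|c _] := @MVT_segment R sin cos 0 x x0.
  exact/continuous_subspaceT/continuous_sin.
by rewrite sin0 !subr0 => ->; rewrite ler_piMl // cos_le1.
Qed.

(** Here [sin x <= x], while [cos x = 1 - 2 sin (x / 2) ^ 2] is at least [1 / 2]. *)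
Lemma cot_lower_bound x : 0 < x -> x <= 2^-1 -> (2 * x)^-1 <= cos x / sin x.
Proof.
move=> x0 x12.
have pi2 := @pihalf_ge1 R.
have sx0 : 0 < sin x by apply: sin_gt0_pihalf; lra.
have sx := sin_le_id (ltW x0).
have cx : 2^-1 <= cos x.
  have : sin (x / 2) ^+ 2 <= (x / 2) ^+ 2.
    apply: lerXn2r; rewrite ?nnegrE.
    - by apply: sin_ge0_pi; lra.
    - lra.
    - apply: sin_le_id; lra.
  have -> : cos x = 1 - 2 * sin (x / 2) ^+ 2.
    have {1}-> : x = (x / 2) *+ 2 by rewrite -mulr_natr; field.
    by rewrite cos_mulr2n cos2sin2; ring.
  nra.
rewrite invfM ler_pM ?invr_ge0 // ?(ltW x0) // lef_pV2 ?posrE //.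
Qed.

Definition unit_root n : R[i] := let x := pi *+ 2 / n%:R in (cos x +i* sin x)%C.

Lemma unit_root_expr n k :
  unit_root n ^+ k = (cos (pi / n%:R * k%:R *+ 2) +i* sin (pi / n%:R * k%:R *+ 2))%C.
Proof.
elim: k => [|k IHk]; first by rewrite mulr0 mul0rn cos0 sin0 expr0.
rewrite exprSr IHk /unit_root; set x := pi *+ 2 / n%:R.
have -> : pi / n%:R * k.+1%:R *+ 2 = pi / n%:R * k%:R *+ 2 + x :> R.
  rewrite /x -natr1; ring.
move: (pi / n%:R * k%:R *+ 2) => y.
rewrite cosD sinD; apply/eqP; rewrite eq_complex /=; apply/andP; split; apply/eqP; ring.
Qed.

Lemma sin_unit_angle n k : (0 < k < n)%N -> 0 < sin (pi / n%:R * k%:R : R).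
Proof.
move=> /andP[k0 kn]; have n0 : 0 < n%:R :> R by rewrite ltr0n; lia.
have x0 : 0 < pi / n%:R * k%:R :> R.
  by rewrite mulr_gt0 ?divr_gt0 ?pi_gt0 // ltr0n.
apply: sin_gt0_pi; rewrite x0 /=.
by rewrite mulrAC ltr_pdivrMr // ltr_pM2l ?pi_gt0 // ltr_nat.
Qed.

(** A smaller order [d] would give [cos (2 x) = 1] at [x = pi d / n], although [sin x > 0]. *)
Lemma unit_rootP n : (0 < n)%N -> n.-primitive_root (unit_root n).
Proof.
move=> n0; have nR0 : n%:R != 0 :> R by rewrite pnatr_eq0 -lt0n.
have un1 : unit_root n ^+ n = 1 by rewrite unit_root_expr divfK // cos2pi sin2pi.
have [d dprim ddvd] := prim_order_exists n0 un1.
have [dn|dn] := eqVneq d n; first by rewrite -{1}dn.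
have kn : (0 < d < n)%N.
  by rewrite (prim_order_gt0 dprim) ltn_neqAle dn dvdn_leq.
have sd := sin_unit_angle kn.
have /eqP := prim_expr_order dprim; rewrite unit_root_expr eq_complex /=.
rewrite cos_mulr2n cos2sin2 => /andP[/eqP E _]; exfalso.
have : sin (pi / n%:R * d%:R : R) ^+ 2 > 0 by rewrite exprn_gt0.
lra.
Qed.

(** Half-angle formulas: [1 + e^(2 i x) = 2 cos x e^(i x)] and
    [1 - e^(2 i x) = - 2 i sin x e^(i x)]. *)
Lemma unit_root_cot n k : (0 < k < n)%N ->
  (1 + unit_root n ^+ k) / (1 - unit_root n ^+ k) =
  'i * (cos (pi / n%:R * k%:R) / sin (pi / n%:R * k%:R))%:C%C.
Proof.
move=> kn; have := sin_unit_angle kn; rewrite unit_root_expr.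
move: (pi / n%:R * k%:R) => x sx.
pose c : R[i] := (cos x)%:C%C; pose s : R[i] := (sin x)%:C%C.
have s0 : s != 0 by rewrite /s eq_complex /= gt_eqF.
have i2 : 'i * 'i = -1 :> R[i] by rewrite -expr2 sqrCi.
have cs : c * c + s * s = 1.
  by rewrite /c /s -!rmorphM -rmorphD -!expr2 cos2Dsin2.
have u0 : c + 'i * s != 0.
  apply/eqP => u0; have : (c + 'i * s) * (c - 'i * s) = 1.
    rewrite -[RHS]cs; transitivity (c * c - ('i * 'i) * s * s); first by ring.
    rewrite i2; ring.
  by rewrite u0 mul0r => /eqP; rewrite eq_sym oner_eq0.
have -> : (cos (x *+ 2) +i* sin (x *+ 2))%C = (c + 'i * s) ^+ 2.
  rewrite cos_mulr2n sin_mulr2n /c /s -complexiE; apply/eqP.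
  have := cos2Dsin2 x; rewrite !expr2 eq_complex /= => E; apply/andP; split; apply/eqP; simpl; lra.
have -> : 1 - (c + 'i * s) ^+ 2 = - (2 * ('i * s) * (c + 'i * s)).
  rewrite -[X in X - _]cs; transitivity
    (s * s - ('i * 'i) * s * s - 2 * ('i * s) * (c + 'i * s) + 2 * ('i * 'i) * s * s);
    first by ring.
  rewrite i2; ring.
have -> : 1 + (c + 'i * s) ^+ 2 = 2 * c * (c + 'i * s).
  rewrite -[X in X + _]cs; transitivity
    (c * c + c * c + s * s + ('i * 'i) * s * s + 2 * ('i * s) * c); first by ring.
  rewrite i2; ring.
have -> : (cos x / sin x)%:C%C = c / s :> R[i] by rewrite rmorphM fmorphV.
have i0 : 'i != 0 :> R[i] by rewrite neq0Ci.
apply: (mulIf (_ : 'i != 0)) => //.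
rewrite [RHS](_ : _ = - (c / s)); last first.
  by rewrite mulrAC i2 mulN1r.
by field; apply/and3P; split.
Qed.

Lemma ln_le_harmonic (L : nat) : ln L.+1%:R <= \sum_(l < L) l.+1%:R^-1 :> R.
Proof.
elim: L => [|L IHL]; first by rewrite big_ord0 ln1.
rewrite big_ord_recr /=.
have L0 : 0 < L.+1%:R :> R by rewrite ltr0n.
have -> : L.+2%:R = L.+1%:R * (1 + L.+1%:R^-1) :> R.
  by rewrite mulrDr mulr1 divff ?gt_eqF // natr1.
have I0 : 0 < L.+1%:R^-1 :> R by rewrite invr_gt0.
rewrite lnM ?posrE ?addr_gt0 //; apply: lerD => //.
by apply: le_ln1Dx; apply: lt_trans I0; rewrite ltrN10.
Qed.

End Trigonometry.

(** * Summing the cotangents and choosing the parameters *)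

Lemma sum_multiples_le (R : numDomainType) (f : nat -> R) (m L : nat) :
  (0 < m)%N -> (forall j, (j < m * L)%N -> 0 <= f j) ->
  \sum_(l < L) f (l * m)%N <= \sum_(j < m * L) f j.
Proof.
move=> m0; elim: L => [|L IHL] f0; first by rewrite muln0 !big_ord0.
rewrite mulnS addnC big_split_ord big_ord_recr /=; apply: lerD.
  by apply: IHL => j jL; apply: f0; lia.
rewrite -(prednK m0) big_ord_recl /= addn0 prednK // mulnC lerDl.
by apply: sumr_ge0 => j _; apply: f0; have := ltn_ord j; rewrite /bump /=; lia.
Qed.

(** Only the upper half of the rows is kept; each of them contains all differences [1, ..., m L], of
    which those equal to 1 modulo [m] are retained. *)
Lemma sum_differences_ge (R : numDomainType) (f : nat -> R) (m L : nat) :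
  (0 < m)%N -> (forall k, (0 < k < m * L + m * L)%N -> 0 <= f k) ->
  (m * L)%:R * \sum_(l < L) f (l * m).+1 <=
  \sum_(i < m * L + m * L) \sum_(j < m * L + m * L)
    if (j < i)%N then f (i - j)%N else 0.
Proof.
move=> m0; set n := (m * L)%N => f0.
have rowE (i : 'I_(n + n)) : \sum_(j < n + n) (if (j < i)%N then f (i - j)%N else 0)
    = \sum_(j < i) f j.+1.
  have iN := ltnW (ltn_ord i).
  rewrite -big_mkcond (big_ord_narrow iN) /= (reindex_inj rev_ord_inj) /=.
  by apply: eq_bigr => j _; congr f; have := ltn_ord j; lia.
rewrite (eq_bigr _ (fun i _ => rowE i)) big_split_ord /=.
rewrite -[leLHS]add0r; apply: lerD.
  apply: sumr_ge0 => i _; apply: sumr_ge0 => j _; apply: f0.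
  by have := ltn_ord i; have := ltn_ord j; lia.
have -> : n%:R * \sum_(l < L) f (l * m).+1 = \sum_(i < n) \sum_(l < L) f (l * m).+1.
  by rewrite sumr_const card_ord mulr_natl.
apply: ler_sum => i _; rewrite big_split_ord /= -[leLHS]addr0; apply: lerD.
  apply: (@sum_multiples_le R (fun j => f j.+1)) => // j jn; apply: f0.
  by rewrite -/n in jn; lia.
apply: sumr_ge0 => j _; apply: f0; have := ltn_ord i; have := ltn_ord j; lia.
Qed.

Lemma has_order_norm (R : rcfType) (q k : nat) (chi : dirichletChar R q) (n : int) :
  has_order chi k -> coprimez n q%:Z -> `|chi n| = 1.
Proof.
move=> ord cn; have k0 := has_order_pos ord.
apply/eqP; rewrite -(pexpr_eq1 k0) ?normr_ge0 // -normrX.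
by rewrite (has_order_expr ord cn) normr1.
Qed.

Lemma max_char_sum_ge (R : rcfType) (q : nat) (chi : dirichletChar R q) (t : 'I_q) :
  (1 < q)%N -> `|\sum_(n < t.+1) chi n%:Z| <= (max_char_sum chi)%:C%C.
Proof.
(* [max_char_sum] starts its sums at 1; the extra term at 0 vanishes because [q > 1]. *)
move=> q1; have chi0 : chi 0 = 0.
  by apply: dchar_eq0; rewrite coprimezE /coprime gcd0n; lia.
rewrite -(big_mkord xpredT (fun n => chi n%:Z)) big_ltn // chi0 add0r.
rewrite lecR; have tq : (t < q.+1)%N by rewrite ltnW // ltnS.
exact: (le_bigmax _ (fun t : 'I_q.+1 => Normc.normc (\sum_(1 <= n < t.+1) chi n%:Z)) (Ordinal tq)).
Qed.

Lemma pretentious_max_char_sum_ge (R : realType) (g m q L : nat)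
    (psi : dirichletChar R m) (chi : dirichletChar R q) :
  (1 < m)%N -> (0 < L)%N -> (16 * m * L <= q)%N -> primitive chi ->
  has_order psi g -> has_order chi g ->
  (forall k : nat, (0 < k < m * L + m * L)%N -> coprime k m ->
    chi k%:Z = psi k%:Z /\ chi (- k%:Z) = - psi (- k%:Z)) ->
  Num.sqrt q%:R * ln L%:R <= 16 * m%:R ^+ 2 * max_char_sum chi.
Proof.
move=> m1 L0 mLq prim psig chig same; set N := (m * L + m * L)%N in same *.
have q1 : (1 < q)%N by nia.
have mL0 : (0 < m * L)%N by nia.
(* As [pi < 4], this keeps every angle [pi k / q] with [k < N] below [1 / 2], the range of
   [cot_lower_bound]. *)
have N8 : (8 * N <= q)%N by rewrite /N; lia.
have wq : q.-primitive_root (unit_root R q) by apply: unit_rootP; lia.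
have zm : m.-primitive_root (unit_root R m) by apply: unit_rootP; lia.
have chi1 n := has_order_norm (n := n) chig.
have psi1 n := has_order_norm (n := n) psig.
pose a k : R := pi / q%:R * k%:R.
pose kappa k : R := cos (a k) / sin (a k).
have q0 : 0 < q%:R :> R by rewrite ltr0n; lia.
have kappaL k : (0 < k < N)%N -> q%:R / (8 * k%:R) <= kappa k.
  move=> /andP[k0 kN]; have kR0 : 0 < k%:R :> R by rewrite ltr0n.
  have pi4 : pi < 4 :> R by have := @pihalf_lt2 R; lra.
  have pi0 := @pi_gt0 R.
  have a0 : 0 < a k by rewrite mulr_gt0 ?divr_gt0.
  have a4 : a k <= 4 / q%:R * k%:R.
    by rewrite ler_pM2r // ler_pM2r ?invr_gt0 // ltW.
  have a12 : a k <= 2^-1.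
    apply: le_trans a4 _; rewrite mulrAC ler_pdivrMr //.
    have : (8 * k)%:R <= q%:R :> R by rewrite ler_nat; lia.
    by rewrite natrM; lra.
  apply: le_trans (cot_lower_bound a0 a12).
  rewrite -[q%:R / _]invf_div lef_pV2 ?posrE ?mulr_gt0 ?divr_gt0 ?invr_gt0 ?mulr_gt0 //.
  apply: (@le_trans _ _ (2 * (4 / q%:R * k%:R))); first by rewrite ler_pM2l.
  have -> // : 8 * k%:R / q%:R = 2 * (4 / q%:R * k%:R) :> R.
  by field; rewrite gt_eqF.
have kappa0 k : (0 < k < N)%N -> 0 <= kappa k.
  by move=> kN; apply: le_trans (kappaL k kN); rewrite divr_ge0 ?mulr_ge0.
have kappaE k : (0 < k < N)%N ->
    (1 + unit_root R q ^+ k) / (1 - unit_root R q ^+ k) = 'i * (kappa k)%:C%C.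
  by move=> kN; apply: unit_root_cot; lia.
have Nq : (N <= q)%N by lia.
have sumM t := max_char_sum_ge chi t q1.
have := fejer_lower_bound wq prim q1 zm m1 Nq psi1 sumM same kappa0 kappaE.
have -> : `|gauss_sum chi (unit_root R q) 1| = (Num.sqrt q%:R)%:C%C.
  apply/eqP; rewrite -(eqrXn2 (ltn0Sn 1)) ?normr_ge0 ?ler0c ?sqrtr_ge0 //.
  by rewrite gauss_sum_norm // -rmorphXn sqr_sqrtr ?ler0n // rmorph_nat.
set D : R := \sum_(i < N) _; set M := max_char_sum chi.
rewrite -(rmorph_nat (real_complex R)) -!rmorphM lecR => main.
pose f k := if coprime k m then kappa k else 0.
have DE : D = \sum_(i < N) \sum_(j < N) if (j < i)%N then f (i - j)%N else 0.
  by apply: eq_bigr => i _; apply: eq_bigr => j _; rewrite /f; case: ltnP.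
(* The differences [l m + 1] are prime to [m] and have [kappa] at least [q / (8 m (l + 1))]; the
   harmonic sum over [l] gives the logarithm. *)
have Dge : (m * L)%:R * (q%:R / (8 * m%:R) * ln L%:R) <= D.
  rewrite DE; apply: le_trans (sum_differences_ge (ltnW m1) _); last first.
    by move=> k kN; rewrite /f; case: ifP => // _; apply: kappa0.
  rewrite ler_wpM2l //.
  have lnL : ln L%:R <= \sum_(l < L) l.+1%:R^-1 :> R.
    apply: le_trans (ln_le_harmonic R L).
    by rewrite ler_ln ?posrE ?ltr0n // ler_nat.
  have qm0 : 0 < q%:R / (8 * m%:R) :> R by rewrite divr_gt0 ?mulr_gt0 ?ltr0n //; lia.
  apply: le_trans (ler_wpM2l (ltW qm0) lnL) _.
  rewrite mulr_sumr; apply: ler_sum => l _; have lL := ltn_ord l.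
  have lN : (0 < (l * m).+1 < N)%N by rewrite /N; nia.
  rewrite /f ifT; last by rewrite coprime_sym -addn1 /coprime gcdnMDl gcdn1.
  apply: le_trans (kappaL _ lN).
  rewrite -mulrA -invfM ler_pM2l // lef_pV2 ?posrE ?mulr_gt0 ?ltr0n //; last by lia.
  by rewrite -mulrA ler_pM2l // -natrM ler_nat; nia.
have s0 : 0 <= Num.sqrt q%:R :> R := sqrtr_ge0 _.
have step := le_trans (ler_wpM2l s0 Dge) main.
have m0 : 0 < m%:R :> R by rewrite ltr0n; lia.
have LR0 : 0 < L%:R :> R by rewrite ltr0n.
(* Cancelling [L q / 8] from [L q / 8] and [m q (2 m L)] leaves the constant [16 m ^ 2]. *)
have c0 : 0 < L%:R * q%:R / 8 :> R by rewrite divr_gt0 ?mulr_gt0.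
rewrite -(ler_pM2l c0).
have -> : L%:R * q%:R / 8 * (Num.sqrt q%:R * ln L%:R) =
  Num.sqrt q%:R * ((m * L)%:R * (q%:R / (8 * m%:R) * ln L%:R)) :> R.
  by rewrite natrM; field; rewrite gt_eqF.
apply: le_trans step _; rewrite le_eqVlt; apply/orP; left; apply/eqP.
by rewrite /N !(natrM, natrD); field.
Qed.

(** With [y = 16 m ^ 2 L] one has [q <= y ^ (y + 1)], so [ln q <= (y + 1) (y - 1) <= y ^ 2]; and
    [y <= L ^ 2] gives [ln (ln q) <= 2 ln y <= 4 ln L]. *)
Lemma ln_ln_le (R : realType) (m L q : nat) :
  (1 < m)%N -> (16 * m ^ 2 <= L)%N -> (1 < q)%N ->
  (q <= m * (4 * (16 * m ^ 2 * L)`!))%N ->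
  ln (ln q%:R) <= 4 * ln L%:R :> R.
Proof.
move=> m1 mL q1; set y := (16 * m ^ 2 * L)%N => qy.
have my : (4 * m <= y)%N by rewrite /y; nia.
have y2 : (2 < y)%N by lia.
have yR0 : 0 < y%:R :> R by rewrite ltr0n; lia.
have fact_le n : (n`! <= n ^ n)%N.
  elim: n => // n IHn; rewrite factS expnS leq_mul2l; apply: leq_trans IHn _.
  by case: (n) => // k; rewrite leq_exp2r.
have qyy : (q <= y ^ y.+1)%N.
  by apply: leq_trans qy _; rewrite mulnA [(m * 4)%N]mulnC expnS leq_mul.
have lny : ln y%:R <= y%:R - 1 :> R.
  by rewrite -[y%:R in leLHS](subrK 1) addrC; apply: le_ln1Dx; rewrite ltrBrDl addrN.
have lnq : ln q%:R <= y%:R ^+ 2 :> R.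
  apply: (@le_trans _ _ (ln (y%:R ^+ y.+1))).
    have qyR : q%:R <= y%:R ^+ y.+1 :> R by rewrite -natrX ler_nat.
    by rewrite ler_ln ?posrE ?exprn_gt0 // ltr0n ltnW.
  rewrite lnXn // -[leLHS]mulr_natr -natr1.
  have := ler_wpM2r (_ : 0 <= y%:R + 1) lny; nra.
have lnq0 : 0 < ln q%:R :> R by rewrite ln_gt0 // ltr1n.
apply: (@le_trans _ _ (ln (y%:R ^+ 2))).
  by rewrite ler_ln ?posrE ?exprn_gt0.
have LR0 : 0 < L%:R :> R by rewrite ltr0n; lia.
have yL : y%:R <= L%:R ^+ 2 :> R.
  by rewrite -natrX ler_nat /y expnS leq_mul // expn1.
rewrite lnXn // -[leLHS]mulr_natr mulrC -[4]/(2 * 2)%:R natrM -mulrA ler_pM2l //.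
rewrite mulrC mulr_natr -lnXn // ler_ln ?posrE ?exprn_gt0 //.
Qed.

Theorem theorem1 (R : realType) (g : nat) (g_ge2 : (2 <= g)%N)
    (g_even : ~~ odd g) :
  exists2 c : R, 0 < c &
    forall Y : R, exists (q : nat) (chi : dirichletChar R q),
      [/\ Y < q%:R, primitive chi, has_order chi g
        & c * Num.sqrt q%:R * ln (ln q%:R) <= max_char_sum chi].
Proof.
have g0 : (0 < g)%N by lia.
(* [m] and [psi] are fixed before [Y], so the constant depends on [g] alone. *)
have [m mp [u up]] := exists_prime_primitive_root g0.
have [psi psig] := exists_dchar_order mp up (unit_rootP R g0).
have m1 := prime_gt1 mp.
have mR0 : 0 < m%:R :> R by rewrite ltr0n; lia.
have c0 : 0 < 64 * m%:R ^+ 2 :> R by rewrite mulr_gt0 ?exprn_gt0.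
(* 64 is the 16 of [pretentious_max_char_sum_ge] times the 4 of [ln_ln_le]. *)
exists (64 * m%:R ^+ 2)^-1; first by rewrite invr_gt0.
(* The first summand serves [ln_ln_le], the second forces [q > Y]. *)
move=> Y; pose L := (16 * m ^ 2 + Num.bound `|Y|)%N.
(* From [y < m q] this yields [16 m L < q], and [y] exceeds every difference below [2 m L]. *)
pose y := (16 * m ^ 2 * L)%N.
have my : (1 < m <= y)%N by rewrite /y /L; nia.
have [q [chi [prim chig qle yq same]]] := exists_pretentious_dchar g_even psig my.
exists q, chi.
have mLq : (16 * m * L < q)%N.
  by rewrite -(ltn_pmul2l (ltnW m1)); apply: leq_ltn_trans yq; rewrite /y; nia.
have L0 : (0 < L)%N by rewrite /L; nia.
have q1 : (1 < q)%N by nia.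
split=> //.
  apply: le_lt_trans (ler_norm Y) _; apply: lt_trans (archi_boundP (normr_ge0 Y)) _.
  rewrite ltr_nat; apply: leq_ltn_trans mLq; apply: leq_trans (leq_addl (16 * m ^ 2) _) _.
  by rewrite -/L leq_pmull //; lia.
have main : Num.sqrt q%:R * ln L%:R <= 16 * m%:R ^+ 2 * max_char_sum chi.
  apply: (pretentious_max_char_sum_ge m1 L0 (ltnW mLq) prim psig chig).
  by move=> k kN; apply: same; rewrite /y; nia.
have lnlnq := ln_ln_le R m1 (leq_addr _ _ : (16 * m ^ 2 <= L)%N) q1 qle.
rewrite -mulrA ler_pdivrMl //.
apply: le_trans (ler_wpM2l (sqrtr_ge0 _) lnlnq) _.
lra.
Qed.
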